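(* The Banach space $\mathfrak X$ is not distortable; that is, for every equivalent norm $|||\cdot|||$ on $\mathfrak X$ one has $$d(\mathfrak X,|||\cdot|||)=\inf_Y\ \sup\Big\{\frac{|||x|||}{|||y|||}: x,y\in Y,\ \|x\|=\|y\|=1\Big\}=1,$$ where the infimum is taken over all infinite dimensional subspaces $Y$ of $\mathfrak X$.
   Context: Scalars are real. $c_{00}(\omega_1)$ is the space of finitely supported functions $\omega_1\to\mathbb R$, with canonical Hamel basis $(e_\alpha)_{\alpha<\omega_1}$; an element $\phi\in c_{00}(\omega_1)$ acts as a functional by $\phi(x)=\sum_\alpha \phi(\alpha)x(\alpha)$, and $e_\alpha^*$ is $e_\alpha$ regarded as a functional. For sets of ordinals $s<t$ means that every element of $s$ is smaller than every element of $t$; for vectors $x<y$ means $\mathrm{supp}\,x<\mathrm{supp}\,y$. A block sequence is a $<$-increasing sequence (of finite sets, or of finitely supported vectors). The function $\varrho$. Fix $\varrho:[\omega_1]^2\to\omega$ such that for all $\alpha<\beta<\gamma<\omega_1$: $\varrho(\alpha,\gamma)\le\max\{\varrho(\alpha,\beta),\varrho(\beta,\gamma)\}$ and $\varrho(\alpha,\beta)\le\max\{\varrho(\alpha,\gamma),\varrho(\beta,\gamma)\}$; and $\{\alpha<\beta:\varrho(\alpha,\beta)\le n\}$ is finite for all $\beta<\omega_1$, $n\in\omega$. Put $\varrho(\alpha,\alpha)=0$. For $s,t\subseteq\omega_1$, $\varrho(s,t)=\min\{\varrho(\alpha,\beta):\alpha\in s,\beta\in t\}$. A sequence $(s_i)_i$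 of sets is $p$-separated if $\varrho(s_i,s_j)\ge p$ for all $i\ne j$, and separated if it is $|\bigcup_i s_i|$-separated. These notions apply to vectors and functionals via their supports. For finite $F\subseteq\omega_1$ let $p_\varrho(F)=\max\{\varrho(\alpha,\beta):\alpha,\beta\in F\}$ and $\overline F^{\,p}=\{\alpha:\exists\beta\in F,\ \alpha\le\beta,\ \varrho(\alpha,\beta)\le p\}$ (a finite set). Parameters: $m_1=2$, $m_{j+1}=m_j^4$; $n_1=4$, $n_{j+1}=(4n_j)^{s_j}$ with $s_j=\log_2 m_{j+1}^3$. Coding. $Q_s(\omega_1)$ is the set of finite sequences $\Phi=(\phi_1,w_1,p_1,\dots,\phi_d,w_d,p_d)$ with $\phi_1<\dots<\phi_d$ nonzero elements of $c_{00}(\omega_1)$ with rational values, $(w_i)$ and $(p_i)$ strictly increasing sequences of positive integers, and $p_i\ge p_\varrho(\bigcup_{k\le i}\mathrm{supp}\,\phi_k)$ for all $i\le d$. $Q_s$ is the (countable) set of finite sequences of the same form with $\phi_i\in c_{00}(\omega)$, satisfying the same requirements except the last one. Fix a one-to-one $\sigma:Q_s\to\{2j: j\text{ odd}\}$ with $\sigma(\phi_1,w_1,p_1,\dots,\phi_d,w_d,p_d)>\max\{p_d^2,1/\varepsilon^2,\max\mathrm{supp}\,\phi_d\}$, where $\varepsilon=\min\{|\phi_k(\alpha)|:\alpha\in\mathrm{supp}\,\phi_k,\ k\le d\}$. For $\Phi\in Q_s(\omega_1)$ let $G=\overline{\bigcup_{i\le d}\mathrm{supp}\,\phi_i}^{\,p_d}$,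 let $\pi_G:\{1,\dots,|G|\}\to G$ be the increasing enumeration, let $\pi_G(\phi_k)(n)=\phi_k(\pi_G(n))$ for $1\le n\le|G|$ and $0$ otherwise, and set $\sigma_\varrho(\Phi)=\sigma(\pi_G(\phi_1),w_1,p_1,\dots,\pi_G(\phi_d),w_d,p_d)$. Norming set. $K$ is the minimal subset of $c_{00}(\omega_1)$ such that: (i) $K$ contains all $e_\gamma^*$, is symmetric, and is closed under restriction to intervals of $\omega_1$; (ii) for every $j\geq 1$ and every separated block sequence $(\phi_i)_{i=1}^d\subseteq K$ with $d\le n_{2j}$, $\frac1{m_{2j}}\sum_{i=1}^d\phi_i\in K$; (iii) for every $j\ge1$ and every separated $(2j+1)$-special sequence $(\phi_i)_{i=1}^d\subseteq K$ with $d\le n_{2j+1}$, $\frac1{m_{2j+1}}\sum_{i=1}^d\phi_i\in K$; (iv) $K$ is closed under rational convex combinations. A functional of the form given in (ii) or (iii) with factor $1/m_j$ is said to have weight $w(\phi)=m_j$ (and to be of type I). A block sequence $(\phi_1,\dots,\phi_d)$ in $K$ is $(2j+1)$-special if each $\phi_k$ has a weight $w(\phi_k)=m_{2j_k}$, with $j_1$ even and $m_{2j_1}>n_{2j+1}^2$, and there are integers $p_1<\dots<p_{d-1}$ such that for all $1\le i<d$, $\Phi_i=(\phi_1,w(\phi_1),p_1,\dots,\phi_i,w(\phi_i),p_i)\in Q_s(\omega_1)$ and $w(\phi_{i+1})=m_{\sigma_\varrho(\Phi_i)}$. $\mathfrak X$ is the completion of $c_{00}(\omega_1)$ under the norm $\|x\|=\sup\{\phi(x):\phi\in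 K\}$. *)

(* Defs.v *)
From HB Require Import structures.
From mathcomp Require Import all_boot all_order all_algebra finmap.
From mathcomp Require Import all_classical all_reals all_analysis.
Set Implicit Arguments.
Unset Strict Implicit.
Unset Printing Implicit Defensive.
Import Order.TTheory GRing.Theory Num.Theory.
Import numFieldNormedType.Exports.
Local Open Scope classical_set_scope.
Local Open Scope ring_scope.

(* Finite sequences (x_1, ..., x_d) are given by their length d and a function
   on nat, only the values at k < d being relevant: x_(k+1) is [x k]. *)

(* The order type omega_1: the uncountable well-order all of whose proper
   initial segments are countable. *)
Definition is_omega1 (disp : Order.disp_t) (W : orderType disp) : Prop :=
  [/\ forall A : set W, A !=set0 ->
        exists2 a, A a & forall b, A b -> (a <= b)%O,
      ~ countable [set: W]
    & forall a : W, countable [set b : W | (b < a)%O]].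

Section FinitelySupported.
Variables (R : realType) (disp : Order.disp_t) (T : orderType disp).
Implicit Types (x y f : T -> R) (phi : nat -> T -> R).

Definition supp f : set T := [set a | f a != 0].

Definition c00 : set (T -> R) := [set f | finite_set (supp f)].

Definition unit_vec (c : T) : T -> R := fun a => (a == c)%:R.

Definition pairing f x : R := \sum_(a \in [set: T]) f a * x a.

Definition supp_lt x y : Prop :=
  forall a b, supp x a -> supp y b -> (a < b)%O.

Definition block (d : nat) phi : Prop :=
  forall i j, (i < j < d)%N -> supp_lt (phi i) (phi j).

Definition supp_union (d : nat) phi : set T :=
  \bigcup_(i in [set i | (i < d)%N]) supp (phi i).

Definition restrict_itv (I : interval T) f : T -> R :=
  fun a => if a \in I then f a else 0.

(* A code (phi_1, w_1, p_1, ..., phi_d, w_d, p_d) is a list of triples. *)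
Definition fcode := seq ((T -> R) * nat * nat).

Definition code_phi (Phi : fcode) (k : nat) : T -> R :=
  (nth (fun=> 0, 0%N, 0%N) Phi k).1.1.
Definition code_w (Phi : fcode) (k : nat) : nat :=
  (nth (fun=> 0, 0%N, 0%N) Phi k).1.2.
Definition code_p (Phi : fcode) (k : nat) : nat :=
  (nth (fun=> 0, 0%N, 0%N) Phi k).2.

(* The requirements common to Q_s and Q_s(omega_1); codes are nonempty. *)
Definition is_code (Phi : fcode) : Prop :=
  (0 < size Phi)%N /\
  [/\ forall k, (k < size Phi)%N ->
        [/\ c00 (code_phi Phi k), exists a, code_phi Phi k a != 0
          & forall a, exists q : rat, code_phi Phi k a = ratr q],
      block (size Phi) (code_phi Phi),
      forall k, (k < size Phi)%N -> (0 < code_w Phi k)%N /\ (0 < code_p Phi k)%N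
    & forall k l, (k < l < size Phi)%N ->
        (code_w Phi k < code_w Phi l)%N /\ (code_p Phi k < code_p Phi l)%N].

End FinitelySupported.

Definition Qs (R : realType) : set (fcode R nat) := [set Phi | is_code Phi].

(* The clause on epsilon = min |phi_k(alpha)| is stated for each of the
   values |phi_k(alpha)|. *)
Definition is_coding (R : realType) (sigma : fcode R nat -> nat) : Prop :=
  {in @Qs R &, injective sigma} /\
  forall Phi, Qs Phi ->
    let d := size Phi in
    [/\ exists2 j, odd j & sigma Phi = (2 * j)%N,
        (code_p Phi d.-1 ^ 2 < sigma Phi)%N,
        forall k a, (k < d)%N -> supp (code_phi Phi k) a ->
          1 / `|code_phi Phi k a| ^+ 2 < (sigma Phi)%:R
      & forall a, supp (code_phi Phi d.-1) a -> (a < sigma Phi)%N].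

(* Only the values at j >= 1 matter. *)
Fixpoint m_ (j : nat) : nat :=
  match j with
  | 0 | 1 => 2
  | i.+1 => m_ i ^ 4
  end%N.

(* m_ j is a power of 2, so trunc_log 2 is the exact logarithm here. *)
Definition s_ (j : nat) : nat := trunc_log 2 (m_ j.+1 ^ 3)%N.

Fixpoint n_ (j : nat) : nat :=
  match j with
  | 0 | 1 => 4
  | i.+1 => (4 * n_ i) ^ s_ i
  end%N.

Section Rho.
Variables (disp : Order.disp_t) (W : orderType disp) (rho : W -> W -> nat).

(* rho is defined on unordered pairs, hence symmetric as a binary function. *)
Definition is_rho : Prop :=
  [/\ forall a b, rho a b = rho b a,
      forall a, rho a a = 0%N,
      forall a b c, (a < b)%O -> (b < c)%O ->
        (rho a c <= maxn (rho a b) (rho b c))%N,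
      forall a b c, (a < b)%O -> (b < c)%O ->
        (rho a b <= maxn (rho a c) (rho b c))%N
    & forall b n, finite_set [set a | (a < b)%O /\ (rho a b <= n)%N]].

Definition p_rho (F : {fset W}) : nat :=
  \max_(a <- enum_fset F) \max_(b <- enum_fset F) rho a b.

Definition rho_closure (F : set W) (p : nat) : set W :=
  [set a | exists b, [/\ F b, (a <= b)%O & (rho a b <= p)%N]].

Variable R : realType.
Implicit Types (phi : nat -> W -> R).

Definition p_separated (p d : nat) phi : Prop :=
  forall i j, (i < d)%N -> (j < d)%N -> i != j ->
    forall a b, supp (phi i) a -> supp (phi j) b -> (p <= rho a b)%N.

Definition rho_separated (d : nat) phi : Prop :=
  p_separated #|` fset_set (supp_union d phi)| d phi.

Definition Qs_omega1 : set (fcode R W) := [set Phi | is_code Phi /\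
  forall i, (i < size Phi)%N ->
    (p_rho (fset_set (supp_union i.+1 (code_phi Phi))) <= code_p Phi i)%N].

(* pi_G(f): it is 0 at 0, lists the values of f along the increasing
   enumeration of G at 1, ..., |G|, and is 0 afterwards. *)
Definition transport (G : {fset W}) (f : W -> R) : nat -> R :=
  fun n => nth 0 (0 :: [seq f a | a <- sort <=%O (enum_fset G)]) n.

Variable sigma : fcode R nat -> nat.

Definition sigma_rho (Phi : fcode R W) : nat :=
  let d := size Phi in
  let G := fset_set
    (rho_closure (supp_union d (code_phi Phi)) (code_p Phi d.-1)) in
  sigma [seq (transport G e.1.1, e.1.2, e.2) | e <- Phi].

(* (2j+1)-special sequences, for a relation [wt i f] standing for "f has
   weight m_ i". Weights need not be unique, so the sequence js of indices
   with w(phi_(k+1)) = m_ (2 * js k) is part of the data. *)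
Definition special (wt : nat -> (W -> R) -> Prop) (j d : nat) phi : Prop :=
  [/\ (0 < d)%N, block d phi
    & exists js ps : nat -> nat,
      [/\ forall k, (k < d)%N -> wt (2 * js k)%N (phi k),
          ~~ odd (js 0%N),
          (n_ (2 * j + 1) ^ 2 < m_ (2 * js 0%N))%N,
          forall k l, (k < l < d.-1)%N -> (ps k < ps l)%N
        & forall i, (0 < i < d)%N ->
            let Phi := [seq (phi k, m_ (2 * js k)%N, ps k) | k <- iota 0 i] in
            Qs_omega1 Phi /\ m_ (2 * js i)%N = m_ (sigma_rho Phi)]].

(* The norming set K, defined simultaneously with the relation
   [has_weight i f]: f is of type I with weight w(f) = m_ i. *)
Inductive K : (W -> R) -> Prop :=
| K_unit (c : W) : K (unit_vec R c)
| K_opp (f : W -> R) : K f -> K (fun a => - f a)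
| K_restrict (I : interval W) (f : W -> R) : K f -> K (restrict_itv I f)
| K_weight (i : nat) (f : W -> R) : has_weight i f -> K f
| K_convex (d : nat) (q : nat -> rat) phi :
    (forall k, (k < d)%N -> K (phi k)) ->
    (forall k, (k < d)%N -> 0 <= q k) ->
    \sum_(k < d) q k = 1 ->
    K (fun a => \sum_(k < d) ratr (q k) * phi k a)
with has_weight : nat -> (W -> R) -> Prop :=
| weight_even (j d : nat) phi :
    (1 <= j)%N -> (1 <= d <= n_ (2 * j))%N ->
    (forall k, (k < d)%N -> K (phi k)) ->
    block d phi -> rho_separated d phi ->
    has_weight (2 * j)%N (fun a => (m_ (2 * j)%N)%:R^-1 * \sum_(k < d) phi k a)
| weight_odd (j d : nat) phi :
    (1 <= j)%N -> (1 <= d <= n_ (2 * j + 1))%N ->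
    (forall k, (k < d)%N -> K (phi k)) ->
    special has_weight j d phi -> rho_separated d phi ->
    has_weight (2 * j + 1)%N
      (fun a => (m_ (2 * j + 1)%N)%:R^-1 * \sum_(k < d) phi k a).

Definition X_norm (x : W -> R) : R := sup [set pairing f x | f in K].

End Rho.

(* X is, through the embedding J (only its values on c00 matter), the
   completion of c00 under the norm N. *)
Definition is_completion (R : realType) (disp : Order.disp_t)
    (W : orderType disp) (N : (W -> R) -> R) (X : completeNormedModType R)
    (J : (W -> R) -> X) : Prop :=
  [/\ forall (c : R) (x y : W -> R), c00 x -> c00 y ->
        J (fun a => c * x a + y a) = c *: J x + J y,
      forall x : W -> R, c00 x -> `|J x| = N x
    & dense (J @` @c00 R disp W)].

Section Distortion.
Variables (R : realType) (X : normedModType R).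

Definition is_norm (N : X -> R) : Prop :=
  [/\ forall x y, N (x + y) <= N x + N y,
      forall (c : R) x, N (c *: x) = `|c| * N x
    & forall x, N x = 0 -> x = 0].

Definition equivalent_norm (N : X -> R) : Prop :=
  is_norm N /\ exists c C : R,
    [/\ 0 < c, 0 < C & forall x, c * `|x| <= N x /\ N x <= C * `|x|].

(* Subspaces of a Banach space are closed; the infimum below would be the same
   over all linear subspaces, as the supremum over Y is that over its closure. *)
Definition is_subspace (Y : set X) : Prop :=
  [/\ Y 0, forall (c : R) x y, Y x -> Y y -> Y (c *: x + y) & closed Y].

Definition finite_dimensional (Y : set X) : Prop :=
  exists (n : nat) (b : 'I_n -> X), (forall i, Y (b i)) /\
    forall y, Y y -> exists c : 'I_n -> R, y = \sum_(i < n) c i *: b i.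

Definition distortion (N : X -> R) : \bar R :=
  ereal_inf [set ereal_sup [set (N x.1 / N x.2)%:E | x in
                   [set x : X * X | [/\ Y x.1, Y x.2, `|x.1| = 1 & `|x.2| = 1]]]
            | Y in [set Y : set X | is_subspace Y /\ ~ finite_dimensional Y]].

End Distortion.

(* Main.v *)
Require Import Defs.
From HB Require Import structures.
From mathcomp Require Import all_boot all_order all_algebra finmap ring lra.
From mathcomp Require Import all_classical all_reals all_analysis.

(* The space contains c_0, and c_0 is not distortable (James).

   If no tail of (e_{alpha_n})_n, for an increasing sequence (alpha_n), is
   equivalent to the c_0-basis, then there is a normalized block sequence (x_n)
   of it whose coefficients are as small as wanted compared with the values of
   rho on the supports of the previous x_i.  When two members of a separated
   sequence meet the supports of x_0, ..., x_{n-1}, such a value bounds the total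
   cardinality of the supports, so that the sum of the members is negligible on
   x_n; hence induction on the construction of K bounds |phi(sum a_n x_n)| by
   6 max |a_n|.

   James' theorem is applied to the norm of the space and then, on the blocks so
   obtained, to the equivalent norm; c_00 is represented by {poly R} with the
   sup norm of the coefficients. *)

Set Implicit Arguments.
Unset Strict Implicit.
Unset Printing Implicit Defensive.
Import Order.TTheory GRing.Theory Num.Theory.
Import numFieldNormedType.Exports.
Local Open Scope classical_set_scope.
Local Open Scope ring_scope.

(** * Finite combinations of a sequence, with polynomials as coefficient vectors *)

Section LinearCombination.
Variables (R : comNzRingType) (V : lmodType R) (v : nat -> V).
Implicit Types p q : {poly R}.

Definition lincomb p : V := \sum_(i < size p) p`_i *: v i.

Lemma lincomb_widen n p : (size p <= n)%N ->
  lincomb p = \sum_(i < n) p`_i *: v i.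
Proof.
move=> le_pn; rewrite /lincomb (big_ord_widen n (fun i => p`_i *: v i) le_pn).
rewrite big_mkcond; apply: eq_bigr => i _.
by case: ltnP => // le_pi; rewrite nth_default // scale0r.
Qed.

Lemma lincomb_is_linear : linear lincomb.
Proof.
move=> c p q; pose n := maxn (size (c *: p + q)) (maxn (size p) (size q)).
rewrite !(@lincomb_widen n) /n ?leq_max ?leqnn ?orbT //.
rewrite scaler_sumr -big_split; apply: eq_bigr => i _ /=.
by rewrite coefD coefZ scalerDl scalerA.
Qed.
HB.instance Definition _ :=
  GRing.isLinear.Build R {poly R} V _ lincomb lincomb_is_linear.

Lemma lincombXn k : lincomb 'X^k = v k.
Proof.
rewrite (@lincomb_widen k.+1) ?size_polyXn // big_ord_recr /= coefXn eqxx.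
rewrite scale1r big1 ?add0r // => i _.
by rewrite coefXn ltn_eqF ?scale0r // ltn_ord.
Qed.

End LinearCombination.

(** * The sup norm on $c_{00}$ and block sequences *)

Section SupNorm.
Variable R : realType.
Implicit Types p q : {poly R}.

Definition supn p : R := \big[Num.max/0]_(i < size p) `|p`_i|.

Lemma supn_ge0 p : 0 <= supn p.
Proof. exact: bigmax_ge_id. Qed.

Lemma ler_supn p i : `|p`_i| <= supn p.
Proof.
case: (ltnP i (size p)) => [ip|pi].
  exact: (le_bigmax _ (fun i : 'I_(size p) => `|p`_i|) (Ordinal ip)).
by rewrite nth_default // normr0 supn_ge0.
Qed.

Lemma supn_le p M : 0 <= M -> (forall i, `|p`_i| <= M) -> supn p <= M.
Proof. by move=> M0 pM; apply: bigmax_le. Qed.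

Lemma supn_eq0 p : supn p = 0 -> p = 0.
Proof.
move=> p0; apply/polyP => i; rewrite coef0; apply/eqP.
by rewrite -normr_le0 -[leRHS]p0 ler_supn.
Qed.

Lemma supnZ c p : supn (c *: p) = `|c| * supn p.
Proof.
apply/eqP; rewrite eq_le; apply/andP; split.
  apply: supn_le => [|i]; first by rewrite mulr_ge0 ?supn_ge0.
  by rewrite coefZ normrM ler_wpM2l ?ler_supn.
have [->|c0] := eqVneq c 0; first by rewrite normr0 mul0r supn_ge0.
have c0' : 0 < `|c| by rewrite normr_gt0.
rewrite mulrC -ler_pdivlMr //; apply: supn_le => [|i].
  by rewrite divr_ge0 ?supn_ge0.
by rewrite ler_pdivlMr // mulrC -normrM -coefZ ler_supn.
Qed.

Lemma supnXn k : supn 'X^k = 1.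
Proof.
apply/eqP; rewrite eq_le; apply/andP; split.
  by apply: supn_le => // i; rewrite coefXn; case: eqP; rewrite ?normr1 ?normr0.
by have := ler_supn 'X^k k; rewrite coefXn eqxx normr1.
Qed.

Definition tail s p := forall i, (i < s)%N -> p`_i = 0.

Lemma tailZ s c p : tail s p -> tail s (c *: p).
Proof. by move=> tp i /tp; rewrite coefZ => ->; rewrite mulr0. Qed.

Lemma tail_le s t p : (s <= t)%N -> tail t p -> tail s p.
Proof. by move=> st tp i /leq_trans/(_ st)/tp. Qed.

Lemma tailXn k : tail k 'X^k.
Proof. by move=> i ik; rewrite coefXn ltn_eqF. Qed.

(** The intervals [[s k, s k.+1)] partition the indices from [s 0] on. Every such coordinate then
    belongs to one definite block, and [s k] bounds all indices of the earlier blocks. *)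
Definition blocks (s : nat -> nat) (w : nat -> {poly R}) :=
  (forall k, (s k < s k.+1)%N) /\
  forall k i, (w k)`_i != 0 -> (s k <= i < s k.+1)%N.

(** A choice [F] of vectors in the tails is iterated, each block starting past the degree of the
    previous one. As [Q] sees the start [s k], a block can be made small relative to everything
    before it. *)
Lemma block_sequence (Q : nat -> {poly R} -> Prop) :
  (forall s, exists2 p, tail s p & Q s p) ->
  exists s w, blocks s w /\ forall k, Q (s k) (w k).
Proof.
move=> exQ; have /choice[F FQ] : forall s, exists p, tail s p /\ Q s p.
  by move=> s; have [p] := exQ s; exists p.
(* [t.+1] keeps [s] strictly increasing even if [F t] is zero. *)
pose s k := iter k (fun t => maxn t.+1 (size (F t))) 0%N.
have s_lt k : (s k < s k.+1)%N by rewrite /= leq_max ltnSn.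
exists s, (F \o s); split=> [|k]; last by have [] := FQ (s k).
split=> // k i /= Fi; apply/andP; split.
  by rewrite leqNgt; apply: contra Fi => /(proj1 (FQ _)) ->.
rewrite leq_max ltnNge orbC ltnNge; apply/orP; left.
by apply: contra Fi => ?; rewrite nth_default.
Qed.

Section Blocks.
Variables (s : nat -> nat) (w : nat -> {poly R}).
Hypothesis sw : blocks s w.

Lemma blocks_homo : {homo s : i j / (i <= j)%N}.
Proof.
have [s_lt _] := sw; move=> i j /subnK <-; elim: (j - i)%N => // k IH.
by rewrite addSn (leq_trans IH) // ltnW.
Qed.

Lemma blocks_id k : (k <= s k)%N.
Proof.
have [s_lt _] := sw; elim: k => // k IH.
exact: leq_ltn_trans IH (s_lt k).
Qed.

Lemma blocks_coef_neq j k i : (s k <= i < s k.+1)%N -> j != k -> (w j)`_i = 0.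
Proof.
move=> /andP[ki ik] jk; apply/eqP/negPn/negP => /(proj2 sw) /andP[ji ij].
case: (ltngtP j k) jk => // [jk|kj] _.
  by have := leq_trans ij (leq_trans (blocks_homo jk) ki); rewrite ltnn.
by have := leq_trans ik (leq_trans (blocks_homo kj) ji); rewrite ltnn.
Qed.

Lemma lincomb_blocks_coef p k i : (s k <= i < s k.+1)%N ->
  (lincomb w p)`_i = p`_k * (w k)`_i.
Proof.
move=> ki; pose n := maxn (size p) k.+1.
have kn : (k < n)%N by rewrite leq_max leqnn orbT.
rewrite (@lincomb_widen _ _ _ n) ?leq_maxl // coef_sum (bigD1 (Ordinal kn)) //=.
rewrite coefZ big1 ?addr0 // => j jk.
by rewrite coefZ (blocks_coef_neq ki) ?mulr0.
Qed.

Lemma lincomb_blocks_tail p : tail (s 0%N) (lincomb w p).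
Proof.
move=> i i0; rewrite coef_sum big1 // => j _; rewrite coefZ.
have [->|/(proj2 sw)/andP[ji _]] := eqVneq (w j)`_i 0; first by rewrite mulr0.
by have := leq_trans i0 (leq_trans (blocks_homo (leq0n j)) ji); rewrite ltnn.
Qed.

Lemma blocks_cover i : (s 0%N <= i)%N -> exists k, (s k <= i < s k.+1)%N.
Proof.
move=> si.
have ex : exists k, (i < s k.+1)%N.
  by exists i; exact: (blocks_id i.+1).
case: (ex_minnP ex) => -[|k] ik kmin; first by exists 0%N; rewrite si.
exists k.+1; rewrite ik andbT leqNgt; apply/negP => /kmin.
by rewrite ltnn.
Qed.

(** Each coordinate of the combination is one coefficient of [p] times one coordinate of a block of
    sup norm 1. *)
Lemma supn_lincomb_blocks p : (forall k, supn (w k) = 1) ->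
  supn (lincomb w p) = supn p.
Proof.
move=> w1; apply/eqP; rewrite eq_le; apply/andP; split.
  apply: supn_le => [|i]; first exact: supn_ge0.
  have [i0|/blocks_cover[k ki]] := ltnP i (s 0%N).
    by rewrite lincomb_blocks_tail // normr0 supn_ge0.
  rewrite (lincomb_blocks_coef _ ki) normrM -[leRHS]mulr1.
  by rewrite ler_pM // ?ler_supn // -(w1 k) ler_supn.
apply: supn_le => [|k]; first exact: supn_ge0.
rewrite -[leLHS]mulr1 -(w1 k) -supnZ; apply: supn_le => [|i].
  exact: supn_ge0.
rewrite coefZ; have [->|wi] := eqVneq (w k)`_i 0.
  by rewrite mulr0 normr0 supn_ge0.
by rewrite -lincomb_blocks_coef ?ler_supn //; exact: (proj2 sw).
Qed.

End Blocks.

End SupNorm.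

(** * James' theorem for norms equivalent to the sup norm *)

Section James.
Variable R : realType.

Definition seminorm (V : lmodType R) (N : V -> R) :=
  (forall x y, N (x + y) <= N x + N y) /\
  (forall c x, N (c *: x) = `|c| * N x).

Variables (N : {poly R} -> R) (A B : R).
Hypothesis N_seminorm : seminorm N.
Hypothesis A_gt0 : 0 < A.
Hypothesis N_ge : forall p, A * supn p <= N p.
Hypothesis N_le : forall p, N p <= B * supn p.

Let tail_ball s := [set p : {poly R} | tail s p /\ supn p <= 1].
Let L s := sup (N @` tail_ball s).

Let N_ge0 p : 0 <= N p.
Proof. by apply: le_trans (N_ge p); rewrite mulr_ge0 ?supn_ge0 ?ltW. Qed.

Let B_ge0 : 0 <= B.
Proof.
by have := le_trans (N_ge0 'X^0) (N_le 'X^0); rewrite supnXn mulr1.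
Qed.

Let has_sup_tail s : has_sup (N @` tail_ball s).
Proof.
split.
  by exists (N 'X^s), 'X^s => //; split; [exact: tailXn|rewrite supnXn].
exists B => _ [p [_ p1] <-]; rewrite (le_trans (N_le p)) //.
by rewrite -[leRHS]mulr1 ler_wpM2l.
Qed.

Let L_ge s : A <= L s.
Proof.
apply: (@le_trans _ _ (N 'X^s)).
  by have := N_ge 'X^s; rewrite supnXn mulr1.
apply: sup_upper_bound; first exact: has_sup_tail.
by exists 'X^s => //; split; [exact: tailXn|rewrite supnXn].
Qed.

Let N_le_tail s p : tail s p -> N p <= L s * supn p.
Proof.
move=> tp; have [p0|p0] := eqVneq (supn p) 0.
  by rewrite p0 mulr0 -(mulr0 B) -p0.
have p_gt0 : 0 < supn p by rewrite lt_def p0 supn_ge0.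
rewrite -ler_pdivrMr // mulrC -[X in X * _]ger0_norm ?invr_ge0 ?supn_ge0 //.
rewrite -(proj2 N_seminorm); apply: sup_upper_bound; first exact: has_sup_tail.
exists ((supn p)^-1 *: p) => //; split; first exact: tailZ.
by rewrite supnZ ger0_norm ?invr_ge0 ?supn_ge0 // mulVf.
Qed.

(* James: the blocks [w k] nearly attain the limit [lam] of the tail suprema,
   and reflecting a vector at its [k]-th coordinate turns the upper bound into
   a lower one. *)
Lemma james_block (eps : R) : 0 < eps -> eps < 1 ->
  exists T : {linear {poly R} -> {poly R}}, (forall p, supn (T p) = supn p) /\
  exists2 lam, 0 < lam & forall p,
    (1 - 3 * eps) * lam * supn p <= N (T p) <= (1 + eps) * lam * supn p.
Proof.
move=> e0 e1; pose lam := inf (range L).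
have L_lb : has_lbound (range L) by exists A => _ [s _ <-].
have L_has_inf : has_inf (range L) by split => //; exists (L 0%N), 0%N.
have lam_gt0 : 0 < lam.
  apply: lt_le_trans A_gt0 _; apply: lb_le_inf; first by exists (L 0%N), 0%N.
  by move=> _ [s _ <-].
have lam_le s : lam <= L s by apply: ge_inf => //; exists s.
(* On [tail s0], [N] is at most [(1 + eps) * lam] times the sup norm; all blocks are therefore taken
   in this tail. *)
have [_ [s0 _ <-] Ls0] := inf_adherent (mulr_gt0 e0 lam_gt0) L_has_inf.
have exw s : exists2 p : {poly R}, tail s p &
    [/\ tail s0 p, supn p = 1 & (1 - eps) * lam < N p].
  have [_ [p [tp p1] <-] Np] :=
    sup_adherent (mulr_gt0 e0 lam_gt0) (has_sup_tail (maxn s s0)).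
  have {}Np : (1 - eps) * lam < N p.
    by apply: le_lt_trans Np; have := lam_le (maxn s s0); rewrite -/(L _); lra.
  (* The near-maximizer only has sup norm at most 1. It is nonzero because [N p] is positive, and
     dividing it by its sup norm cannot decrease [N]. *)
  have p_gt0 : 0 < supn p.
    rewrite lt_def supn_ge0 andbT; apply/eqP => p0.
    have := lt_le_trans Np (N_le p); rewrite p0 mulr0 ltNge.
    by rewrite mulr_ge0 ?ltW // subr_gt0.
  exists ((supn p)^-1 *: p).
    by apply: tailZ; apply: tail_le tp; rewrite leq_maxl.
  split; first by apply: tailZ; apply: tail_le tp; rewrite leq_maxr.
    by rewrite supnZ ger0_norm ?invr_ge0 ?supn_ge0 // mulVf ?gt_eqF.
  rewrite (proj2 N_seminorm) ger0_norm ?invr_ge0 ?supn_ge0 //.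
  by apply: (lt_le_trans Np); rewrite ler_peMl // invf_ge1.
have [s [w [sw wQ]]] := block_sequence exw.
have w1 k : supn (w k) = 1 by have [] := wQ k.
have Nw k : (1 - eps) * lam < N (w k) by have [] := wQ k.
have NT p : N (lincomb w p) <= (1 + eps) * lam * supn p.
  rewrite -(supn_lincomb_blocks sw p w1).
  apply: le_trans (@N_le_tail s0 _ _) _.
    move=> i i0; rewrite coef_sum big1 // => j _; rewrite coefZ.
    by have [tw _ _] := wQ j; rewrite tw ?mulr0.
  by apply: ler_wpM2r; [exact: supn_ge0|rewrite mulrDl mul1r ltW].
exists (lincomb w); split.
  by move=> p; exact: supn_lincomb_blocks sw p w1.
exists lam => // p; rewrite NT andbT.
have key k : 2 * (`|p`_k| * ((1 - eps) * lam)) <=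
    N (lincomb w p) + (1 + eps) * lam * supn p.
  have -> : 2 * (`|p`_k| * ((1 - eps) * lam)) =
            `|2 * p`_k| * ((1 - eps) * lam).
    by rewrite normrM ger0_norm // mulrA.
  apply: (@le_trans _ _ (`|2 * p`_k| * N (w k))).
    by rewrite ler_wpM2l // ltW.
  (* [q] keeps the [k]-th coefficient of [p] and negates the others, so its sup norm does not exceed
     that of [p], while [p + q] is a multiple of ['X^k]. *)
  pose q := (2 * p`_k) *: 'X^k - p.
  have -> : `|2 * p`_k| * N (w k) = N (lincomb w p + lincomb w q).
    by rewrite linearB linearZ /= lincombXn addrC subrK (proj2 N_seminorm).
  apply: (le_trans (proj1 N_seminorm _ _)); rewrite lerD2l.
  apply: (le_trans (NT q)); rewrite ler_wpM2l //.
    by rewrite mulr_ge0 ?addr_ge0 // ltW.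
  apply: supn_le => [|i]; first exact: supn_ge0.
  rewrite coefB coefZ coefXn; case: eqP => [->|_].
    by rewrite mulr1 mulrDl mul1r addrK ler_supn.
  by rewrite mulr0 sub0r normrN ler_supn.
have l1 : 0 < (1 - eps) * lam by rewrite mulr_gt0 ?subr_gt0.
have d0 : 0 < 2 * ((1 - eps) * lam) by rewrite mulr_gt0.
(* [key] is maximized over [k]; since [2 (1 - eps) - (1 + eps) = 1 - 3 eps], this is the required
   lower bound. *)
have : supn p <= (N (lincomb w p) + (1 + eps) * lam * supn p) /
                 (2 * ((1 - eps) * lam)).
  apply: supn_le => [|k]; last by rewrite ler_pdivlMr // mulrCA.
  have lam0 := ltW lam_gt0; have e0' := ltW e0.
  by rewrite divr_ge0 ?(ltW d0) // addr_ge0 // ?mulr_ge0 ?supn_ge0 ?addr_ge0.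
rewrite ler_pdivlMr //; lra.
Qed.

End James.

(* The norming set [K]: induction principle and elementary bounds *)
Scheme K_mut := Minimality for K Sort Prop
  with has_weight_mut := Minimality for has_weight Sort Prop.

Lemma m_ge2 i : (2 <= m_ i)%N.
Proof.
elim: i => [|[|i] IH] //; apply: (leq_trans IH).
by rewrite -[X in (X <= _)%N]expn1 leq_exp2l.
Qed.

Lemma ler_norm_sum_single (R : realType) (d : nat) (g : nat -> R) (c : R) :
  0 <= c -> (forall k, (k < d)%N -> `|g k| <= c) ->
  (forall i j, (i < d)%N -> (j < d)%N -> g i != 0 -> g j != 0 -> i = j) ->
  `|\sum_(k < d) g k| <= c.
Proof.
move=> c0 gc g1; have [/existsP[i gi]|/existsPn g0] :=
  boolP [exists i : 'I_d, g i != 0].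
  rewrite (bigD1 i) //= big1 ?addr0 ?gc // => j ji.
  apply/eqP/negPn/negP => gj; case/negP: ji; apply/eqP/val_inj.
  exact: (g1 _ _ (ltn_ord j) (ltn_ord i) gj gi).
rewrite big1 ?normr0 // => i _; apply/eqP/negPn; exact: g0.
Qed.

Section NormingSet.
Variables (R : realType) (disp : Order.disp_t) (W : orderType disp).
Variables (rho : W -> W -> nat) (sigma : fcode R nat -> nat).
Implicit Types (f : W -> R) (phi : nat -> W -> R) (I : interval W).

Local Notation K := (K rho sigma).

(** A single case serves both kinds of weight, as each provides a separated block sequence. It also
    records that the weighted sum lies in [K], so that bounds already known on [K] can be applied to
    it during an induction. *)
Lemma K_elim (P : (W -> R) -> Prop) :
  (forall c, P (unit_vec R c)) ->
  (forall f, K f -> P f -> P (fun a => - f a)) ->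
  (forall I f, K f -> P f -> P (restrict_itv I f)) ->
  (forall i d phi, K (fun a => (m_ i)%:R^-1 * \sum_(k < d) phi k a) ->
     (forall k, (k < d)%N -> K (phi k)) -> (forall k, (k < d)%N -> P (phi k)) ->
     block d phi -> rho_separated rho d phi ->
     P (fun a => (m_ i)%:R^-1 * \sum_(k < d) phi k a)) ->
  (forall d (q : nat -> rat) phi, (forall k, (k < d)%N -> P (phi k)) ->
     (forall k, (k < d)%N -> 0 <= q k) -> \sum_(k < d) q k = 1 ->
     P (fun a => \sum_(k < d) ratr (q k) * phi k a)) ->
  forall f, K f -> P f.
Proof.
move=> Pu Po Pr Pw Pc; apply: (@K_mut _ _ rho R sigma P (fun _ => P)) => //.
- by move=> d q phi _; exact: Pc.
- move=> j d phi j1 d1 Kphi Pphi bphi sphi; apply: Pw => //.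
  by apply: K_weight; exact: weight_even.
- move=> j d phi j1 d1 Kphi Pphi [d0 bphi spec] sphi; apply: Pw => //.
  by apply: K_weight; apply: weight_odd.
Qed.

Lemma supp_union_finite d phi :
  (forall k, (k < d)%N -> finite_set (supp (phi k))) ->
  finite_set (supp_union d phi).
Proof.
move=> fin; apply: bigcup_finite; first exact: finite_II.
by move=> k /= kd; exact: fin.
Qed.

Lemma sub_supp_union d phi (q : nat -> R) :
  supp (fun a => \sum_(k < d) q k * phi k a) `<=` supp_union d phi.
Proof.
move=> a /= /eqP fa; apply: contrapT => na; apply: fa; rewrite big1 // => k _.
have [->|ka] := eqVneq (phi k a) 0; first by rewrite mulr0.
by case: na; exists k => /=.
Qed.

Lemma supp_restrict I f : supp (restrict_itv I f) `<=` supp f.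
Proof. by move=> a; rewrite /supp /= /restrict_itv; case: ifP => // _ /eqP. Qed.

Lemma K_c00 f : K f -> c00 f.
Proof.
apply: K_elim => {f} [c|f _|I f _|i d phi _ _|d q phi].
- apply: (@sub_finite_set _ _ [set c]) => // a.
  by rewrite /supp /unit_vec /=; have [->//|_ /eqP] := eqVneq a c.
- by apply: sub_finite_set => a; rewrite /supp /= oppr_eq0.
- by apply: sub_finite_set; exact: supp_restrict.
- move=> /supp_union_finite fin _ _.
  apply: sub_finite_set fin => a; under eq_fun do rewrite mulr_sumr.
  exact: (@sub_supp_union _ _ (fun=> _)).
- move=> /supp_union_finite fin _ _.
  apply: sub_finite_set fin => a.
  exact: sub_supp_union (fun k => ratr (q k)) _.
Qed.

Lemma block_inj d phi a i j : block d phi -> (i < d)%N -> (j < d)%N ->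
  phi i a != 0 -> phi j a != 0 -> i = j.
Proof.
move=> b id jd ia ja; case: (ltngtP i j) => // ij.
  by have := b i j; rewrite ij jd => /(_ isT a a ia ja); rewrite ltxx.
by have := b j i; rewrite ij id => /(_ isT a a ja ia); rewrite ltxx.
Qed.

Lemma ler_norm_convex d (q : nat -> rat) (g : nat -> R) c :
  (forall k, (k < d)%N -> `|g k| <= c) -> (forall k, (k < d)%N -> 0 <= q k) ->
  \sum_(k < d) q k = 1 -> `|\sum_(k < d) ratr (q k) * g k| <= c.
Proof.
move=> gc q0 q1; apply: (le_trans (ler_norm_sum _ _ _)).
rewrite -[leRHS]mul1r -[X in X * _](rmorph1 (@ratr R)) -q1 rmorph_sum mulr_suml.
apply: ler_sum => k _; have qk : 0 <= ratr (q k) :> R by rewrite ler0q q0.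
by rewrite normrM ger0_norm // ler_wpM2l ?gc.
Qed.

Lemma normr_m_inv_le i : `|(m_ i)%:R^-1 : R| <= 2^-1.
Proof.
have m2 := m_ge2 i; rewrite ger0_norm ?invr_ge0 //.
by rewrite lef_pV2 ?posrE ?ltr0n ?ler_nat // (leq_trans _ m2).
Qed.

(** In the weighted case the supports are disjoint, so at most one summand is nonzero at a given
    point. *)
Lemma K_le1 f : K f -> forall a, `|f a| <= 1.
Proof.
move: f; apply: (K_elim (P := fun f => forall a, `|f a| <= 1))
  => [c|f _|I f _|i d phi _ _|d q phi].
- by move=> a; rewrite /unit_vec; case: eqP; rewrite ?normr1 ?normr0.
- by move=> IH a; rewrite normrN.
- by move=> IH a; rewrite /restrict_itv; case: ifP; rewrite ?normr0.
- move=> IH b _ a; rewrite normrM -[leRHS]mulr1.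
  rewrite ler_pM //; first by apply: (le_trans (normr_m_inv_le i)); lra.
  apply: (@ler_norm_sum_single _ _ (fun k => phi k a)) => // [k kd|k l kd ld].
    exact: IH.
  exact: (block_inj b kd ld).
- move=> IH q0 q1 a; apply: (@ler_norm_convex _ _ (fun k => phi k a)) => // k kd.
  exact: IH.
Qed.

(** * Functionals of [K] on the span of an increasing sequence of unit vectors *)

Section Pairing.
Variable alpha : nat -> W.
Hypothesis alpha_lt : forall i j, (i < j)%N -> (alpha i < alpha j)%O.

(** This is the action of [f] on $\sum_i p_i e_{\alpha_i}$. Writing it as a [lincomb] with values in
    [R^o] makes its linearity in [p] available. *)
Definition ev f (p : {poly R}) : R := lincomb (f \o alpha : nat -> R^o) p.

Lemma alpha_inj : injective alpha.
Proof.
move=> i j ij; case: (ltngtP i j) => // /alpha_lt; by rewrite ij ltxx.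
Qed.

Lemma evE f n (p : {poly R}) : (size p <= n)%N ->
  ev f p = \sum_(i < n) p`_i * f (alpha i).
Proof. by move=> pn; rewrite /ev (@lincomb_widen _ _ _ n). Qed.

Lemma ev_restrict_sum I d (q : nat -> R) phi p :
  ev (restrict_itv I (fun a => \sum_(k < d) q k * phi k a)) p =
  \sum_(k < d) q k * ev (restrict_itv I (phi k)) p.
Proof.
rewrite (@evE _ (size p)) //; under eq_bigr => i _.
  rewrite (_ : _ * _ =
      \sum_(k < d) q k * (p`_i * restrict_itv I (phi k) (alpha i))).
    over.
  rewrite /restrict_itv; case: ifP => _; rewrite ?mulr0.
    by rewrite mulr_sumr; apply: eq_bigr => k _; rewrite mulrCA.
  by rewrite big1 // => k _; rewrite !mulr0.
rewrite exchange_big; apply: eq_bigr => k _ /=.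
by rewrite -mulr_sumr -(@evE _ (size p)).
Qed.

Lemma ev_restrictN I f p :
  ev (restrict_itv I (fun a => - f a)) p = - ev (restrict_itv I f) p.
Proof.
rewrite !(@evE _ (size p)) // -sumrN; apply: eq_bigr => i _.
by rewrite /restrict_itv; case: ifP => _; rewrite ?mulrN ?mulr0 ?oppr0.
Qed.

Lemma restrict_itvI I I' f :
  restrict_itv I' (restrict_itv I f) = restrict_itv (Order.meet I I') f.
Proof.
apply/funext => a; rewrite /restrict_itv in_itvI.
by case: (a \in I); case: (a \in I').
Qed.

(** As [alpha] is injective, at most [#|S|] coefficients of [p] meet the support of [f]. [S] is left
    free so that it can be the union of supports that measures separation. *)
Lemma ler_norm_ev f (p : {poly R}) (S : set W) :
  finite_set S -> supp f `<=` S ->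
  (forall a, `|f a| <= 1) -> `|ev f p| <= supn p * (#|` fset_set S|)%:R.
Proof.
move=> finS fS f1; rewrite (@evE _ (size p)) //.
apply: (le_trans (ler_norm_sum _ _ _)).
rewrite -(big_mkord xpredT (fun i => `|p`_i * f (alpha i)|)).
rewrite (bigID (fun i => f (alpha i) == 0)) /= big1 ?add0r; last first.
  by move=> i /eqP ->; rewrite mulr0 normr0.
apply: (@le_trans _ _ (\sum_(0 <= i < size p | f (alpha i) != 0) supn p)).
  apply: ler_sum => i _; rewrite normrM -[leRHS]mulr1.
  by rewrite ler_pM ?ler_supn ?f1.
rewrite big_const_seq iter_addr addr0 -[leLHS]mulr_natr.
rewrite ler_wpM2l ?supn_ge0 // ler_nat.
rewrite -size_filter -(size_map alpha); apply: uniq_leq_size.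
  by rewrite (map_inj_uniq alpha_inj) filter_uniq // iota_uniq.
move=> _ /mapP[i + ->]; rewrite mem_filter => /andP[fi _].
by rewrite in_fset_set // inE; exact: fS.
Qed.

Section Blocks.
Variables (s : nat -> nat) (x : nat -> {poly R}).
Hypothesis sx : blocks s x.
Hypothesis x_le1 : forall f n, K f -> `|ev f (x n)| <= 1.
Hypothesis x_small : forall n i j, (i < s n)%N -> (j < s n)%N ->
  supn (x n) * (rho (alpha i) (alpha j))%:R <= 2^-1 ^+ n.

Lemma ev_block_eq0 f n : (forall i, (s n <= i < s n.+1)%N -> f (alpha i) = 0) ->
  ev f (x n) = 0.
Proof.
move=> f0; rewrite (@evE _ (size (x n))) // big1 // => i _.
have [->|/(proj2 sx)/f0->] := eqVneq (x n)`_i 0; first by rewrite mul0r.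
by rewrite mulr0.
Qed.

(* If two of the functionals [phi k] meet the first [N] blocks, separation
   bounds the support of all of them by a value of [rho] on these blocks, so that
   the coefficients of [x N] are too small to matter; if at most one does, the
   factor [1 / m_ i <= 1 / 2] pays for it. *)
Lemma K_block_bound f : K f ->
  forall I N (a : nat -> R), (forall n, `|a n| <= 1) ->
  `|\sum_(n < N) a n * ev (restrict_itv I f) (x n)| <= 6.
Proof.
(* Keeping [I] universal absorbs closure under restriction: two restrictions amount to one, to the
   intersection. *)
move: f; apply: (K_elim (P := fun f => forall I N (a : nat -> R),
  (forall n, `|a n| <= 1) ->
  `|\sum_(n < N) a n * ev (restrict_itv I f) (x n)| <= 6))
  => [c|f _ IH|J f _ IH|i d phi Kf Kphi IH b sep|d q phi IH q0 q1] I N a a1.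
(* Only the block whose interval contains the index of [c], if there is one, gives a nonzero
   term. *)
- apply: le_trans (_ : 1 <= 6); last by lra.
  apply: (@ler_norm_sum_single _ _ (fun n => a n *
    ev (restrict_itv I (unit_vec R c)) (x n))) => // [n _|m n _ _].
    rewrite normrM -[leRHS]mulr1 ler_pM //.
    by apply: x_le1; apply: K_restrict; exact: K_unit.
  have hit k : a k * ev (restrict_itv I (unit_vec R c)) (x k) != 0 ->
      exists2 j, (s k <= j < s k.+1)%N & alpha j = c.
    move=> nz; apply: contrapT => nh; case/negP: nz; apply/eqP.
    rewrite ev_block_eq0 ?mulr0 // => j jk; rewrite /restrict_itv /unit_vec.
    by case: ifP => // _; case: eqP => // jc; case: nh; exists j.
  move=> /(hit m)[j jm jc] /(hit n)[l ln].
  rewrite -jc => /alpha_inj lj; subst l.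
  by case: (ltngtP m n) => // mn;
    move: jm ln => /andP[j1 j2] /andP[j3 j4];
    [have := leq_trans j2 (leq_trans (blocks_homo sx mn) j3)
    |have := leq_trans j4 (leq_trans (blocks_homo sx mn) j1)]; rewrite ltnn.
- under eq_bigr do rewrite ev_restrictN mulrN.
  by rewrite sumrN normrN; exact: IH.
- by under eq_bigr do rewrite restrict_itvI; exact: IH.
- set f := (X in restrict_itv I X).
  have f1 u : `|restrict_itv I f u| <= 1 by apply: K_le1; exact: K_restrict.
  have fE u : f u = \sum_(k < d) (m_ i)%:R^-1 * phi k u by rewrite /f mulr_sumr.
  have fS : supp (restrict_itv I f) `<=` supp_union d phi.
    apply: subset_trans (@supp_restrict _ _) _.
    by rewrite (funext fE); exact: (@sub_supp_union _ _ (fun=> _)).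
  have finS : finite_set (supp_union d phi).
    by apply: supp_union_finite => k /Kphi/K_c00.
  (* [phi k] is nonzero, within [I], at some coordinate preceding the block [x n]. *)
  pose hit n k := exists2 j, (j < s n)%N &
    restrict_itv I (phi k) (alpha j) != 0.
  (* With at most one [phi k] involved, the induction hypothesis bounds its sum by 6 and the weight
     halves this to 3. *)
  have single n : (forall k l, (k < d)%N -> (l < d)%N ->
      hit n k -> hit n l -> k = l) ->
      `|\sum_(l < n) a l * ev (restrict_itv I f) (x l)| <= 3.
    move=> one; pose g k := (m_ i)%:R^-1 *
      \sum_(l < n) a l * ev (restrict_itv I (phi k)) (x l).
    have -> : \sum_(l < n) a l * ev (restrict_itv I f) (x l) = \sum_(k < d) g k.
      under eq_bigr => l _.
        rewrite (funext fE) (@ev_restrict_sum _ _ (fun=> _)) mulr_sumr.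
        under eq_bigr do rewrite mulrCA.
        over.
      by rewrite exchange_big; apply: eq_bigr => k _; rewrite -mulr_sumr.
    apply: ler_norm_sum_single => // [k kd|k l kd ld gk gl].
      rewrite normrM (_ : 3 = 2^-1 * 6); last by field.
      by rewrite ler_pM ?normr_m_inv_le ?IH.
    have hitP r : g r != 0 -> hit n r.
      move=> nz; apply: contrapT => nh; case/negP: nz; rewrite /g big1 ?mulr0 //.
      move=> t _; rewrite ev_block_eq0 ?mulr0 // => j /andP[_ jt].
      apply/eqP/negPn/negP => jr; apply: nh; exists j => //.
      exact: leq_trans jt (blocks_homo sx (ltn_ord t)).
    by apply: one => //; exact: hitP.
  (* The term [2 * 2^-1 ^+ N] is a reserve: passing to [N.+1] releases exactly [2^-1 ^+ N], which
     pays for a negligible term. When at most one functional is hit, the sum is bounded afresh by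
     [3 + 1], and the reserve is then at most 1. *)
  suff: `|\sum_(n < N) a n * ev (restrict_itv I f) (x n)| + 2 * 2^-1 ^+ N <= 6.
    by apply: le_trans; rewrite lerDl mulr_ge0 // exprn_ge0 // invr_ge0.
  elim: N => [|N IHN]; first by rewrite big_ord0 normr0 expr0; lra.
  have e1 : 2^-1 ^+ N <= 1 :> R by rewrite exprn_ile1 //; lra.
  rewrite big_ord_recr /= exprS.
  have tri := ler_normD (\sum_(n < N) a n * ev (restrict_itv I f) (x n))
    (a N * ev (restrict_itv I f) (x N)).
  have a_le : `|a N * ev (restrict_itv I f) (x N)| <=
      `|ev (restrict_itv I f) (x N)|.
    by rewrite normrM ler_piMl.
  have [one|] := pselect (forall k l, (k < d)%N -> (l < d)%N ->
      hit N k -> hit N l -> k = l).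
    have := single _ one; have : `|ev (restrict_itv I f) (x N)| <= 1.
      by apply: x_le1; exact: K_restrict.
    lra.
  move=> /existsNP[k /existsNP[l /not_implyP[kd /not_implyP[ld]]]].
  move=> /not_implyP[[j jN jk] /not_implyP[[t tN tl] /eqP kl]].
  suff : `|ev (restrict_itv I f) (x N)| <= 2^-1 ^+ N by lra.
  apply: le_trans (x_small jN tN); apply: (le_trans (ler_norm_ev _ finS fS f1)).
  rewrite ler_wpM2l ?supn_ge0 // ler_nat; apply: (sep k l) => //.
    exact: supp_restrict jk.
  exact: supp_restrict tl.
- under eq_bigr => n _.
    rewrite (@ev_restrict_sum _ _ (fun k => ratr (q k))) mulr_sumr.
    under eq_bigr do rewrite mulrCA.
    over.
  rewrite exchange_big; under eq_bigr do rewrite -mulr_sumr.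
  apply: (@ler_norm_convex _ _ (fun k => \sum_(n < N)
    a n * ev (restrict_itv I (phi k)) (x n))) => // k kd.
  exact: IH.
Qed.

End Blocks.
End Pairing.
End NormingSet.

(** * An isomorphic copy of $c_0$ in [X] *)

Section ContainsC0.
Variables (R : realType) (disp : Order.disp_t) (W : orderType disp).
Variables (rho : W -> W -> nat) (sigma : fcode R nat -> nat).
Variables (X : completeNormedModType R) (J : (W -> R) -> X).
Hypothesis hX : is_completion (X_norm rho sigma) J.
Variable alpha : nat -> W.
Hypothesis alpha_lt : forall i j, (i < j)%N -> (alpha i < alpha j)%O.

Local Notation K := (K rho sigma).
Local Notation U := (lincomb (fun i => J (unit_vec R (alpha i)))).
Local Notation ev := (ev alpha).

Let vec n (c : nat -> R) : W -> R :=
  fun a => \sum_(i < n) c i * unit_vec R (alpha i) a.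

Let vecE n c i : (i < n)%N -> vec n c (alpha i) = c i.
Proof.
move=> iltn; rewrite /vec (bigD1 (Ordinal iltn)) //= /unit_vec eqxx mulr1.
rewrite big1 ?addr0 // => j ji; rewrite (inj_eq (alpha_inj alpha_lt)).
by case: eqP => [ij|]; rewrite ?mulr0 //; case/eqP: ji; apply: val_inj.
Qed.

Let vec_out n c a : a \notin [seq alpha i | i <- iota 0 n] -> vec n c a = 0.
Proof.
move=> na; rewrite /vec big1 // => i _; rewrite /unit_vec; case: eqP => [ai|].
  by case/mapP: na; exists (i : nat) => //; rewrite mem_iota ltn_ord.
by rewrite mulr0.
Qed.

Let vec_c00 n c : c00 (vec n c).
Proof.
apply: (@sub_finite_set _ _ [set` [seq alpha i | i <- iota 0 n]]) => // a.
by apply: contraPT => /(@vec_out _ c) va; rewrite /supp /= va => /eqP.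
Qed.

Let J_vec n c : J (vec n c) = \sum_(i < n) c i *: J (unit_vec R (alpha i)).
Proof.
have [Jlin _ _] := hX; elim: n => [|n IH].
  (* [J] is linear on [c00] in the form [c * x + y]; taking [c = -1] and [x = y = 0] gives
     [J 0 = 0]. *)
  have e0 : (fun a => -1 * vec 0 c a + vec 0 c a) = vec 0 c.
    by apply/funext => a; rewrite /vec big_ord0 mulr0 addr0.
  by rewrite big_ord0 -{1}e0 Jlin // scaleN1r addNr.
have -> : vec n.+1 c = fun a => c n * unit_vec R (alpha n) a + vec n c a.
  by apply/funext => a; rewrite /vec big_ord_recr addrC.
rewrite Jlin ?IH; first by rewrite big_ord_recr addrC.
  by apply: (@K_c00 _ _ _ rho sigma); exact: K_unit.
exact: vec_c00.
Qed.

Let pairing_vec f (p : {poly R}) : pairing f (vec (size p) (nth 0 p)) = ev f p.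
Proof.
rewrite /pairing (fsbigE [seq alpha i | i <- iota 0 (size p)]) //.
- rewrite big_map (evE _ _ (leqnn _)).
  rewrite -(big_mkord xpredT (fun i => p`_i * f (alpha i))).
  rewrite /index_iota subn0 big_seq_cond [RHS]big_seq_cond.
  apply: eq_big => [i|i /andP[ip _]]; first by rewrite in_setT.
  by rewrite vecE 1?mulrC //; move: ip; rewrite mem_iota.
- by rewrite (map_inj_uniq (alpha_inj alpha_lt)) iota_uniq.
- by move=> a _ /(@vec_out _ (nth 0 p)) ->; rewrite mulr0.
Qed.

Let normUE (p : {poly R}) : `|U p| = sup [set ev f p | f in K].
Proof.
have [_ Jn _] := hX; rewrite /lincomb -(J_vec (size p) (nth 0 p)) Jn.
  congr (sup _); apply/seteqP.
  by split=> _ [f Kf <-]; exists f; rewrite ?pairing_vec.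
exact: vec_c00.
Qed.

(** Symmetry of [K] supplies the absolute value. The supremum defining the norm is finite because
    members of [K] are bounded by 1 pointwise. *)
Lemma ler_ev_norm f p : K f -> `|ev f p| <= `|U p|.
Proof.
move=> Kf; have ub : has_sup [set ev f p | f in K].
  split; first by exists (ev f p), f.
  exists (\sum_(i < size p) `|p`_i|) => _ [g Kg <-].
  rewrite (evE _ _ (leqnn _)); apply: (le_trans (ler_norm _)).
  apply: (le_trans (ler_norm_sum _ _ _)); apply: ler_sum => i _.
  by rewrite normrM ler_piMr // (K_le1 Kg).
rewrite normUE ler_norml; apply/andP; split; last first.
  by apply: sup_upper_bound => //; exists f.
rewrite lerNl; apply: sup_upper_bound => //; exists (fun a => - f a).
  exact: K_opp.
rewrite !(evE _ _ (leqnn _)) -sumrN; apply: eq_bigr => i _.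
by rewrite mulrN.
Qed.

Lemma norm_le_ev p M : (forall f, K f -> `|ev f p| <= M) -> `|U p| <= M.
Proof.
move=> le_M; rewrite normUE; apply: ge_sup.
  exists (ev (unit_vec R (alpha 0%N)) p), (unit_vec R (alpha 0%N)) => //.
  exact: K_unit.
by move=> _ [f Kf <-]; exact: le_trans (ler_norm _) (le_M f Kf).
Qed.

(** The functionals $e^*_{\alpha_i}$ in [K] read off the coefficients. *)
Lemma supn_le_norm p : supn p <= `|U p|.
Proof.
apply: supn_le => // i.
apply: le_trans (ler_ev_norm p (K_unit rho sigma (alpha i))).
rewrite (@evE _ _ _ _ _ (maxn (size p) i.+1)) ?leq_maxl //.
have ip : (i < maxn (size p) i.+1)%N by rewrite leq_max leqnn orbT.
rewrite (bigD1 (Ordinal ip)) //= /unit_vec eqxx mulr1 big1 ?addr0 // => j ji.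
rewrite (inj_eq (alpha_inj alpha_lt)).
by case: eqP => [ij|]; rewrite ?mulr0 //; case/eqP: ji; apply: val_inj.
Qed.

Lemma ev_lincomb f (x : nat -> {poly R}) p :
  ev f (lincomb x p) = \sum_(n < size p) p`_n * ev f (x n).
Proof.
rewrite /ev [lincomb x p]/lincomb linear_sum.
by apply: eq_bigr => n _; rewrite linearZ.
Qed.

Lemma alpha_le : {mono alpha : i j / (i <= j)%N >-> (i <= j)%O}.
Proof.
move=> i j; case: (ltngtP i j) => [/alpha_lt/ltW//|/alpha_lt ji|->].
  by apply/negbTE; rewrite -ltNge.
by rewrite lexx.
Qed.

(** Restricting a functional to the interval of ordinals that carries [x k] isolates one term, and
    [K] is closed under such restrictions. *)
Lemma norm_block_le s x (p : {poly R}) k : blocks s x ->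
  `|p`_k| * `|U (x k)| <= `|U (lincomb x p)|.
Proof.
move=> sx; rewrite -normrZ -linearZ; apply: norm_le_ev => f Kf.
pose I := Interval (BLeft (alpha (s k))) (BLeft (alpha (s k.+1))).
have -> : ev f (p`_k *: x k) = ev (restrict_itv I f) (lincomb x p).
  pose n := maxn (size (p`_k *: x k)) (size (lincomb x p)).
  rewrite !(@evE _ _ _ _ _ n) ?leq_maxl ?leq_maxr //; apply: eq_bigr => i _.
  rewrite /restrict_itv in_itv /= alpha_le ltNge alpha_le -ltnNge coefZ.
  have [ki|ki] := boolP (s k <= i < s k.+1)%N.
    by rewrite (lincomb_blocks_coef sx _ ki).
  have [->|/(proj2 sx)] := eqVneq (x k)`_i 0; first by rewrite !mulr0 mul0r.
  by rewrite (negbTE ki).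
by apply: ler_ev_norm; exact: K_restrict.
Qed.

(** After division by [supn p], this is [K_block_bound] with the whole of [W] as interval. *)
Lemma norm_lincomb_blocks s x (p : {poly R}) :
  blocks s x -> (forall n, `|U (x n)| <= 1) ->
  (forall n i j, (i < s n)%N -> (j < s n)%N ->
     supn (x n) * (rho (alpha i) (alpha j))%:R <= 2^-1 ^+ n) ->
  `|U (lincomb x p)| <= 6 * supn p.
Proof.
move=> sx x1 x_small; have [p0|p0] := eqVneq (supn p) 0.
  by rewrite (supn_eq0 p0) !linear0 normr0 mulr_ge0 ?supn_ge0.
have p_gt0 : 0 < supn p by rewrite lt_def p0 supn_ge0.
apply: norm_le_ev => f Kf; rewrite -ler_pdivrMr // ev_lincomb.
rewrite -[X in _ * X^-1](ger0_norm (ltW p_gt0)) -normfV -normrM mulr_suml.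
under eq_bigr do rewrite mulrAC.
have -> : f = restrict_itv (Interval (BInfty _ true) (BInfty _ false)) f.
  by apply/funext => a; rewrite /restrict_itv in_itv.
apply: (@K_block_bound _ _ _ rho sigma alpha alpha_lt s x sx _ x_small f Kf _ _
  (fun n => p`_n / supn p)).
  by move=> g n Kg; exact: le_trans (ler_ev_norm _ Kg) (x1 n).
move=> n; rewrite normrM normfV (gtr0_norm p_gt0).
by rewrite ler_pdivrMr ?mul1r ?ler_supn.
Qed.

Lemma shift_blocks k :
  blocks (fun n => (k + n)%N) (fun n => 'X^(k + n) : {poly R}).
Proof.
split=> [n|n i]; first by rewrite addnS.
rewrite coefXn; have [->|_ /eqP//] := eqVneq i (k + n)%N.
by rewrite addnS leqnn ltnSn.
Qed.

(** If no tail satisfies an upper $c_0$-estimate, every tail contains norm-one vectors with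
    arbitrarily small coefficients. *)
Lemma small_block :
  (forall k C, exists2 p : {poly R}, tail k p & C * supn p < `|U p|) ->
  forall k, exists2 p : {poly R}, tail k p & `|U p| = 1 /\
    forall i j, (i < k)%N -> (j < k)%N ->
      supn p * (rho (alpha i) (alpha j))%:R <= 2^-1 ^+ k.
Proof.
(* The sum [P] dominates every value of [rho] concerned. *)
move=> big k; pose P := (\sum_(i < k) \sum_(j < k) rho (alpha i) (alpha j))%N.
have [p tp Up] := big k (2 ^+ k * P%:R).
have Up0 : 0 < `|U p|.
  by apply: le_lt_trans Up; rewrite !mulr_ge0 ?supn_ge0.
exists (`|U p|^-1 *: p); first exact: tailZ.
split; first by rewrite linearZ normrZ normfV normr_id mulVf ?gt_eqF.
move=> i j ik jk; rewrite supnZ normfV normr_id -mulrA mulrC ler_pdivrMr //.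
rewrite exprVn ler_pdivlMl ?exprn_gt0 //; apply: le_trans (ltW Up).
rewrite -[leRHS]mulrA ler_wpM2l ?exprn_ge0 // mulrC ler_wpM2r ?supn_ge0 //.
rewrite ler_nat /P (bigD1 (Ordinal ik)) //=; apply: leq_trans (leq_addr _ _).
by rewrite (bigD1 (Ordinal jk)) //= leq_addr.
Qed.

(** Either some tail of the $e_{\alpha_n}$ satisfies an upper $c_0$-estimate and serves as it is, or
    [small_block] yields blocks for which the constant 6 works. *)
Lemma contains_c0 : exists T : {linear {poly R} -> {poly R}}, exists C,
  forall p, supn p <= `|U (T p)| /\ `|U (T p)| <= C * supn p.
Proof.
have [[k [C UC]]|big] := pselect (exists k C,
    forall p : {poly R}, tail k p -> `|U p| <= C * supn p).
  exists (lincomb (fun n => 'X^(k + n))), C => p.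
  rewrite -(supn_lincomb_blocks (shift_blocks k)); last first.
    by move=> n; exact: supnXn.
  split; first exact: supn_le_norm.
  by apply: UC; have := lincomb_blocks_tail (shift_blocks k) p; rewrite addn0.
have [|s [x [sx xQ]]] := block_sequence (small_block _).
  move=> k C; apply: contrapT => no; apply: big; exists k, C => p tp.
  by rewrite leNgt; apply/negP => pC; apply: no; exists p.
exists (lincomb x), 6 => p; split.
  apply: supn_le => // k; apply: le_trans (norm_block_le p k sx).
  by have [-> _] := xQ k; rewrite mulr1.
apply: (norm_lincomb_blocks _ sx) => [n|n i j im jm].
  by have [-> _] := xQ n.
have [_ /(_ i j im jm) small] := xQ n; apply: (le_trans small).
(* [small_block] gives the bound [2^-1 ^+ s n], and [n <= s n]. *)
apply: ler_wiXn2l; rewrite ?invr_ge0 ?invf_le1 ?ler1n //.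
exact: blocks_id sx n.
Qed.

End ContainsC0.

(** A greatest element [a] would make [W] countable, as the union of the segment below [a] and of
    [a] itself. A choice of larger elements can therefore be iterated. *)
Lemma omega1_sequence (disp : Order.disp_t) (W : orderType disp) :
  is_omega1 W -> exists alpha : nat -> W,
    forall i j, (i < j)%N -> (alpha i < alpha j)%O.
Proof.
move=> [_ unc seg]; have [w0 _] : [set: W] !=set0.
  by apply/set0P/eqP => W0; apply: unc; rewrite W0; exact: countable0.
have /choice[next nextP] : forall a : W, exists b, (a < b)%O.
  move=> a; apply: contrapT => amax; apply: unc.
  have cU : countable (\bigcup_(i in [set: bool])
      if i then [set b | (b < a)%O] else [set a]).
    apply: bigcup_countable; first exact/finite_set_countable/finite_finset.
    by case=> _; [exact: seg|exact: countable1].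
  apply: sub_countable cU; apply: subset_card_le => b _.
  case: (ltgtP b a) => [ba|ab|->]; first by exists true.
    by case: amax; exists b.
  by exists false.
exists (fun n => iter n next w0).
apply: (homo_ltn (r := fun a b : W => (a < b)%O)
  (f := fun n => iter n next w0)).
  by move=> a b c; exact: lt_trans.
by move=> n; exact: nextP.
Qed.

(** * Bounding the distortion from both sides *)

Section DistortionBounds.
Variables (R : realType) (X : normedModType R) (N : X -> R).
Hypothesis hN : equivalent_norm N.

(** Each competing subspace contains a unit vector [x], and the pair [(x, x)] contributes the ratio
    1. *)
Lemma distortion_ge1 : (1 <= distortion N)%E.
Proof.
have [[_ NZ N0] _] := hN.
apply: le_ereal_inf_tmp => _ [Y [[Y0 Ylin _] Yinf] <-].
have [y [Yy y0]] : exists y, Y y /\ y != 0.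
  apply: contrapT => no; apply: Yinf; exists 0%N, (fun=> 0); split=> // y Yy.
  exists (fun=> 0); rewrite big_ord0; apply: contrapT => /eqP y0.
  by apply: no; exists y.
(* The [+ 0] gives [x] the shape required by the closure condition of [is_subspace]. *)
pose x := `|y|^-1 *: y + 0.
have x1 : `|x| = 1 by rewrite /x addr0 normrZ normfV normr_id mulVf ?normr_eq0.
have Yx : Y x by exact: Ylin.
apply: ereal_sup_ubound; exists (x, x) => //=.
rewrite divff //; apply/eqP => /N0 x0.
by move: x1; rewrite x0 normr0 => /eqP; rewrite eq_sym oner_eq0.
Qed.

Variable V : {linear {poly R} -> X}.

(** The norm closure of the range of [V], as subspaces are required to be closed. *)
Definition closed_range : set X :=
  [set x | forall e, 0 < e -> exists p, `|x - V p| < e].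

Lemma sub_closed_range p : closed_range (V p).
Proof. by move=> e e0; exists p; rewrite subrr normr0. Qed.

Lemma closed_range_subspace : is_subspace closed_range.
Proof.
have half e : 0 < e -> 0 < e / 2 :> R by move=> e0; rewrite divr_gt0.
split=> [|c x y Yx Yy|x xY] /=.
- by rewrite -(linear0 V); exact: sub_closed_range.
- move=> e e0; have c0 : 0 < `|c| + 1 by rewrite ltr_wpDl.
  have [p xp] := Yx (e / 2 / (`|c| + 1)) (divr_gt0 (half e e0) c0).
  have [q yq] := Yy (e / 2) (half e e0).
  exists (c *: p + q); rewrite linearP opprD addrACA -scalerBr.
  apply: (le_lt_trans (ler_normD _ _)); rewrite normrZ.
  have : `|c| * `|x - V p| <= e / 2; last by lra.
  move: xp; rewrite ltr_pdivlMr // => /ltW; apply: le_trans.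
  by rewrite mulrC ler_wpM2l // lerDl.
- move=> e e0; have [y [Yy]] := xY _ (nbhsx_ballx x (e / 2) (half e e0)).
  rewrite -ball_normE /= => xy; have [p yp] := Yy (e / 2) (half e e0).
  by exists p; have := ler_distD y x (V p); lra.
Qed.

(** If [n] vectors spanned [Y], the images of [n.+1] monomials would have a coordinate matrix with
    more rows than columns; a nonzero vector of its left kernel is a nonzero polynomial killed by
    [V]. *)
Lemma injective_range_infinite (Y : set X) : injective V ->
  (forall p, Y (V p)) -> ~ finite_dimensional Y.
Proof.
move=> Vinj YV [n [b [_ span]]].
have /choice[M Mb] : forall k : 'I_n.+1, exists c : 'I_n -> R,
    V 'X^k = \sum_(i < n) c i *: b i by move=> k; exact: span.
pose A := \matrix_(k < n.+1, i < n) M k i.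
have : kermx A != 0.
  by rewrite kermx_eq0 -row_leq_rank -ltnNge ltnS rank_leq_col.
move=> /eqP ker0.
have [j kj] : exists j, row j (kermx A) != 0.
  by apply: contrapT => no; apply: ker0; apply/row_matrixP => j;
    rewrite row0; apply: contrapT => /eqP jk; apply: no; exists j.
pose p : {poly R} := \poly_(k < n.+1) (kermx A j (inord k)).
have Vp : V p = V 0.
  rewrite linear0 /p poly_def linear_sum /=.
  have -> : \sum_(k < n.+1) V ((kermx A j (inord k)) *: 'X^k) =
      \sum_(i < n) (kermx A *m A) j i *: b i.
    under [RHS]eq_bigr => i _ do rewrite mxE scaler_suml.
    rewrite exchange_big; apply: eq_bigr => k _ /=.
    rewrite linearZ /= Mb scaler_sumr inord_val; apply: eq_bigr => i _.
    by rewrite scalerA [A k i]mxE.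
  by rewrite mulmx_ker big1 // => i _; rewrite mxE scale0r.
case/eqP: kj; apply/rowP => k; rewrite mxE [RHS]mxE.
have := congr1 (fun q : {poly R} => q`_k) (Vinj _ _ Vp).
by rewrite /= coef_poly ltn_ord inord_val coef0.
Qed.

(** [N] is Lipschitz for the norm of [X], so both estimates pass to the closure of the range, where
    [N] lies between [c1] and [c2] on unit vectors. *)
Lemma distortion_le c1 c2 : injective V -> 0 < c1 -> 0 < c2 ->
  (forall p, c1 * `|V p| <= N (V p) <= c2 * `|V p|) ->
  (distortion N <= (c2 / c1)%:E)%E.
Proof.
move=> Vinj c10 c20 VN; have [[ND NZ N0] [c [C [c0 C0 cNC]]]] := hN.
have NN x : N (- x) = N x by rewrite -scaleN1r NZ normrN1 mul1r.
have N_near x y : N x <= N y + C * `|x - y|.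
  rewrite -{1}(subrK y x); apply: (le_trans (ND _ _)).
  by rewrite addrC lerD2l; have [] := cNC (x - y).
have Ybound x : closed_range x -> c1 * `|x| <= N x <= c2 * `|x|.
  (* [C] accounts for the error in [N], and [k], which will be [c1] or [c2], for the error in the
     multiple of the norm. *)
  move=> Yx; have near e k : 0 < e -> 0 < k ->
      exists p, (C + k) * `|x - V p| <= e.
    move=> e0 k0; have Ck : 0 < C + k by exact: addr_gt0.
    have [p /ltW xp] := Yx (e / (C + k)) (divr_gt0 e0 Ck).
    by exists p; rewrite mulrC -ler_pdivlMr.
  apply/andP; split; apply/ler_addgt0Pr => e e0.
    have [p xp] := near e c1 e0 c10; have /andP[Vp _] := VN p.
    have := N_near (V p) x; rewrite distrC => Np.
    have := ler_wpM2l (ltW c10) (lerB_dist x (V p)).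
    lra.
  have [p xp] := near e c2 e0 c20; have /andP[_ Vp] := VN p.
  have Np := N_near x (V p).
  have := ler_wpM2l (ltW c20) (lerB_dist (V p) x); rewrite (distrC (V p)).
  lra.
apply: ge_ereal_inf; exists (ereal_sup [set (N x.1 / N x.2)%:E | x in
    [set x : X * X | [/\ closed_range x.1, closed_range x.2,
                         `|x.1| = 1 & `|x.2| = 1]]]).
  exists closed_range => //; split; first exact: closed_range_subspace.
  exact: injective_range_infinite sub_closed_range.
apply: ge_ereal_sup => _ [[x y] /= [Yx Yy x1 y1] <-].
have /andP[_ Nx] := Ybound x Yx; have /andP[Ny _] := Ybound y Yy.
rewrite x1 mulr1 in Nx; rewrite y1 mulr1 in Ny.
have Ny0 := lt_le_trans c10 Ny.
rewrite lee_fin ler_pdivrMr // mulrAC ler_pdivlMr //.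
by apply: (le_trans (ler_wpM2r (ltW c10) Nx)); rewrite ler_wpM2l // ltW.
Qed.

End DistortionBounds.

(** * Two successive applications of James' theorem *)

Lemma seminorm_comp (R : realType) (V' V : lmodType R) (T : {linear V' -> V})
  (N : V -> R) : seminorm N -> seminorm (N \o T).
Proof.
by move=> [ND NZ]; split=> [x y|c x] /=; rewrite ?linearD ?linearZ ?ND ?NZ.
Qed.

Theorem corollary3p3 (R : realType) (disp : Order.disp_t)
    (W : orderType disp) (hW : is_omega1 W)
    (rho : W -> W -> nat) (hrho : is_rho rho)
    (sigma : fcode R nat -> nat) (hsigma : is_coding sigma)
    (X : completeNormedModType R) (J : (W -> R) -> X)
    (hX : is_completion (X_norm rho sigma) J)
    (N : X -> R) (hN : equivalent_norm N) :
  distortion N = 1%E.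
Proof.
have [alpha alpha_lt] := omega1_sequence hW.
have [T [C TC]] := contains_c0 hX alpha_lt.
have [[ND NZ N0] [c [D [c0 D0 cND]]]] := hN.
pose U : {linear {poly R} -> X} :=
  lincomb (fun i => J (unit_vec R (alpha i))) \o T.
apply/eqP; rewrite eq_le distortion_ge1 // andbT.
apply/lee_addgt0Pr => d d0; rewrite -EFinD.
(* For [0 < e <= 1/16] one has [(1 + e)^2 <= (1 + 16 e) (1 - 3 e)^2]; with [16 e <= d], the final
   ratio is at most [1 + d]. *)
pose e := Num.min d 1 / 16.
have e0 : 0 < e by rewrite divr_gt0 // lt_min d0 ltr01.
have e16 : e <= 16^-1 by rewrite ler_pdivrMr // mulVf // ge_min lexx orbT.
have ed : 16 * e <= d by rewrite mulrC divfK // ge_min lexx.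
have e1 : e < 1 by lra.
have normS : seminorm (fun p => `|U p|).
  by apply: (seminorm_comp U (N := fun x : X => `|x|)); split=> [x y|a x];
    [exact: ler_normD|rewrite normrZ].
have [T1 [T1s [l1 l10 T1U]]] : exists T1 : {linear {poly R} -> {poly R}},
    (forall p, supn (T1 p) = supn p) /\ exists2 lam, 0 < lam & forall p,
    (1 - 3 * e) * lam * supn p <= `|U (T1 p)| <= (1 + e) * lam * supn p.
  apply: (james_block (A := 1) (B := C) normS) => // p; have [] := TC p => //.
  by rewrite mul1r.
(* This second use takes place inside the range of [T1]. Since [T2] preserves the sup norm, the
   estimates for the first norm survive. *)
have [T2 [T2s [l2 l20 T2N]]] : exists T2 : {linear {poly R} -> {poly R}},
    (forall p, supn (T2 p) = supn p) /\ exists2 lam, 0 < lam & forall p,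
    (1 - 3 * e) * lam * supn p <= N (U (T1 (T2 p))) <= (1 + e) * lam * supn p.
  apply: (james_block (N := N \o (U \o T1)) (A := c) (B := D * C)) => //.
  - exact: seminorm_comp.
  - move=> p /=; have [h _] := cND (U (T1 p)); apply: le_trans h.
    by rewrite ler_pM2l // -(T1s p); have [] := TC (T1 p).
  - move=> p /=; have [_ h] := cND (U (T1 p)); apply: (le_trans h).
    by rewrite -mulrA ler_pM2l // -(T1s p); have [] := TC (T1 p).
pose V : {linear {poly R} -> X} := U \o (T1 \o T2).
have Vsup p : (1 - 3 * e) * l1 * supn p <= `|V p| <= (1 + e) * l1 * supn p.
  by have := T1U (T2 p); rewrite T2s.
have a0 : 0 < 1 - 3 * e by lra.
have b0 : 0 < 1 + e by lra.
have Vinj : injective V.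
  move=> p q pq; apply/eqP; rewrite -subr_eq0; apply/eqP/supn_eq0.
  have /andP[h _] := Vsup (p - q); move: h.
  rewrite linearB pq subrr normr0 pmulr_rle0 ?mulr_gt0 // => h.
  by apply/eqP; rewrite eq_le h supn_ge0.
(* Both norms are nearly multiples of the sup norm. Eliminating it compares them with each other,
   and [l1] and [l2] cancel in [c2 / c1]. *)
pose c1 := (1 - 3 * e) * l2 / ((1 + e) * l1).
pose c2 := (1 + e) * l2 / ((1 - 3 * e) * l1).
have c10 : 0 < c1 by rewrite divr_gt0 ?mulr_gt0.
have c20 : 0 < c2 by rewrite divr_gt0 ?mulr_gt0.
apply: (le_trans (distortion_le hN Vinj c10 c20 _)).
  move=> p; have /andP[V1 V2] := Vsup p; have /andP[N1 N2] := T2N p.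
  apply/andP; split.
    apply: le_trans N1; rewrite /c1 [leLHS]mulrAC ler_pdivrMr ?mulr_gt0 //.
    by rewrite -[leRHS]mulrA ler_wpM2l ?(mulr_ge0 (ltW a0) (ltW l20)) // mulrC.
  apply: (le_trans N2); rewrite /c2 [leRHS]mulrAC ler_pdivlMr ?mulr_gt0 //.
  by rewrite -[leLHS]mulrA ler_wpM2l ?(mulr_ge0 (ltW b0) (ltW l20)) // mulrC.
rewrite lee_fin; have -> : c2 / c1 = (1 + e) ^+ 2 / (1 - 3 * e) ^+ 2.
  by rewrite /c1 /c2; field; rewrite !gt_eqF.
rewrite ler_pdivrMr ?exprn_gt0 //.
apply: (@le_trans _ _ ((1 + 16 * e) * (1 - 3 * e) ^+ 2)).
  have : 0 <= e * (1 - 16 * e) by rewrite mulr_ge0 ?(ltW e0) //; lra.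
  by rewrite !expr2; nra.
by rewrite ler_wpM2r ?lerD2l // exprn_ge0 // ltW.
Qed.
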